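(* Let $p$ be a prime and let $G$ be a finite non-abelian $p$-group of order $p^{5}$. Then $\mathrm{Out}_{c}(G) \neq 1$ if and only if $|Z(G)|=p$, $Z(G)<G'$ (that is, $Z(G)$ is a proper subgroup of $G'$), and at least one of the following holds: (i) $cl(G)=3$ and $d(G)=3$; or (ii) $cl(G)=4$ and $Z(G) \subseteq [x,G]$ for all $x \in G - G'$.
   Context: For a group $G$: an automorphism $\alpha$ of $G$ is called class-preserving if for each $x\in G$ there exists $g_x\in G$ with $\alpha(x)=g_x^{-1}xg_x$. $\mathrm{Aut}_c(G)$ denotes the group of all class-preserving automorphisms of $G$; it contains the group $\mathrm{Inn}(G)$ of inner automorphisms as a normal subgroup, and $\mathrm{Out}_c(G)=\mathrm{Aut}_c(G)/\mathrm{Inn}(G)$. $Z(G)$ is the center of $G$, $G'$ is the commutator (derived) subgroup, $cl(G)$ is the nilpotence class of $G$, and $d(G)$ is the smallest cardinality of a generating set of $G$. For $x\in G$, $[x,G]$ denotes the set $\{[x,g] \mid g\in G\}$, where $[x,g]=x^{-1}g^{-1}xg$, and $G-G'$ is the set-theoretic complement of $G'$ in $G$. *)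

(* Defs.v *)
From mathcomp Require Import all_boot all_fingroup all_solvable.

Set Implicit Arguments.
Unset Strict Implicit.
Unset Printing Implicit Defensive.

Local Open Scope group_scope.

Section ClassPreserving.

Variable gT : finGroupType.
Implicit Type G : {group gT}.

(* An automorphism of G is a permutation of gT fixing every point outside G;  *)
(* x ^ g is g^-1 * x * g.                                                     *)
Definition Autc G : {set {perm gT}} :=
  [set a in Aut G | [forall x in G, exists g in G, a x == x ^ g]].

Lemma AutcP G a :
  reflect (a \in Aut G /\
           forall x, x \in G -> exists2 g, g \in G & a x = x ^ g)
          (a \in Autc G).
Proof.
rewrite [a \in Autc G]in_set; apply: (iffP andP) => [] [Aa ca]; split=> //.
  by move=> x /(forall_inP ca) /exists_inP [g Gg /eqP]; exists g.
by apply/forall_inP=> x /ca [g Gg axg]; apply/exists_inP; exists g; rewrite ?axg.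
Qed.

Lemma Autc_group_set G : group_set (Autc G).
Proof.
apply/group_setP; split=> [|a b /AutcP[Aa ca] /AutcP[Ab cb]].
  by apply/AutcP; split=> [|x _]; [exact: group1 | exists 1; rewrite ?perm1 ?conjg1].
apply/AutcP; split=> [|x Gx]; first exact: groupM.
have [g Gg axg] := ca x Gx.
have [h Gh bxh] := cb _ (groupJ Gx Gg).
by exists (g * h); rewrite ?groupM // permM axg bxh conjgM.
Qed.

Canonical Autc_group G := group (Autc_group_set G).

(* conj_aut G x is the automorphism y |-> y ^ x of G. *)
Definition Inn G : {set {perm gT}} := conj_aut G @* G.

Canonical Inn_group G := [group of Inn G].

Lemma Inn_normal G : Inn G <| Autc G.
Proof.
have sIA: Inn G \subset Autc G.
  apply/subsetP=> _ /morphimP[g _ Gg ->]; apply/AutcP; split=> [|x Gx].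
    by apply: (subsetP (Aut_conj_aut G G)); rewrite mem_morphim ?(subsetP (normG G)).
  by exists g; rewrite // conj_autE.
apply/andP; split=> //; apply/subsetP=> a /AutcP[Aa _].
rewrite inE; apply/subsetP=> _ /imsetP[_ /morphimP[g Ng Gg ->] ->].
have Gag: a g \in G by rewrite Aut_closed.
suff ->: conj_aut G g ^ a = conj_aut G (a g).
  by rewrite mem_morphim ?(subsetP (normG G)).
have Acg h: h \in G -> conj_aut G h \in Aut G.
  by move=> Gh; apply: (subsetP (Aut_conj_aut G G)); rewrite mem_morphim ?(subsetP (normG G)).
apply: (eq_Aut (A := G)) => [||x Gx]; first by rewrite groupJ ?Acg.
  exact: Acg.
have Gy: a^-1 x \in G by rewrite Aut_closed ?groupV.
rewrite conjgE !permM !conj_autE //.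
by rewrite -!(autmE Aa) morphJ //= !autmE permKV.
Qed.

Definition Outc G : {set coset_of (Inn G)} := Autc G / Inn G.

Canonical Outc_group G := [group of Outc G].

End ClassPreserving.

Arguments AutcP {gT G a}.

(* Main.v *)
Require Import Defs.
From mathcomp Require Import all_boot all_fingroup all_solvable.
From mathcomp Require Import zify.

(** Two mechanisms decide whether G of order p^5 has a class-preserving
    automorphism that is not inner.

    Existence. Suppose that Z(G) has order p and that every x outside G' has
    all of Z(G) among its commutators [x, g]. Then every central automorphism
    x |-> x * f x, for f a homomorphism from G onto Z(G), is class-preserving. It
    can be inner only by an element of Z_2(G), so it fixes the centraliser of
    Z_2(G); choosing the kernel of f not to contain that centraliser gives a
    non-inner one ([Outc_neq1_of_covered_center]). In class 3 with three
    generators the covering condition holds by itself: an exception x would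
    make <x> Z_2(G) an abelian maximal subgroup, contradicting the formula
    |G| = p |G'| |Z(G)| that holds when there is one
    ([Outc_neq1_class3]). In class 4 it is the hypothesis
    ([Outc_neq1_class4]).

    Triviality. A p-group is not the union of p proper subgroups
    ([pgroup_cover]); so if p conjugations suffice to describe an automorphism
    pointwise, one of them is enough ([uniform_conjugator]). This shows that
    Out_c(G) is trivial when G has an abelian maximal subgroup
    ([Outc_abelian_index_p]), and when G / Z(G) is non-abelian of order p^3
    ([Outc_extraspecial_central_quotient]). These two cases exhaust the
    non-abelian groups of order p^5 whose centre has more than p elements
    ([Outc_large_center]), and the first applies in class 4 when some x
    outside G' does not cover the centre ([Outc_eq1_class4]). What remains is
    a centre of order p in class 2, or in class 3 with a number of generators
    other than three; there the bound |Aut_c(G)| <= |G'|^d(G)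
    ([card_Autc_leq]) does not exceed |G / Z(G)| = p^4 = |Inn(G)|, four or more
    generators being impossible in class 3. *)

Set Implicit Arguments.
Unset Strict Implicit.
Unset Printing Implicit Defensive.
Local Open Scope group_scope.

(** * Orders of p-groups as exponents *)

Definition order_exponent (T : finType) p (A : {set T}) := logn p #|A|.

(** The order of one and the same set can be typed along several paths from
    groups or quotients to finite types. The tactic gives all of them the same
    form, marking those treated with [order_exponent], then names each exponent
    so that linear arithmetic applies. *)
Ltac card_lia :=
  repeat match goal with H : context [logn _ _] |- _ => revert H end;
  rewrite /=;
  repeat match goal with |- context [@reverse_coercion Finite.type Type ?f ?u] =>
    change (@reverse_coercion Finite.type Type f u) with f
  end;
  repeat match goal with
    |- context [@quotient_coset_of__canonical__fintype_Finite ?T ?A] =>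
    change (@quotient_coset_of__canonical__fintype_Finite T A)
      with (fingroup_FinGroup__to__fintype_Finite
              (@quotient_coset_of__canonical__fingroup_FinGroup T A))
  end;
  repeat match goal with |- context [fingroup_FinStarMonoid__to__fintype_Finite
      (fingroup_FinGroup__to__fingroup_FinStarMonoid ?T)] =>
    change (fingroup_FinStarMonoid__to__fintype_Finite
     (fingroup_FinGroup__to__fingroup_FinStarMonoid T))
      with (fingroup_FinGroup__to__fintype_Finite T)
  end;
  repeat match goal with
  | |- context [logn ?p (@card.body ?f (@mem ?s ?t (@pred_of_set.body ?g ?A)))] =>
    change (logn p (@card.body f (@mem s t (@pred_of_set.body g A))))
      with (@order_exponent f p A)
  end;
  repeat match goal with |- context [@order_exponent ?T ?p ?A] =>
    let n := fresh "n" in generalize (@order_exponent T p A) => n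
  end;
  clear; lia.

Lemma logn_Lagrange (gT : finGroupType) (G H : {group gT}) (p : nat) :
  H \subset G -> logn p #|G| = (logn p #|H| + logn p #|G : H|)%N.
Proof. by move=> sHG; rewrite -(Lagrange sHG) lognM. Qed.

Lemma pgroup_logn_subset_eq (gT : finGroupType) (G H : {group gT}) (p : nat) :
  p.-group G -> H \subset G -> logn p #|G| <= logn p #|H| -> H :=: G.
Proof.
move=> pG sHG leGH; apply/eqP; rewrite eqEproper sHG /=.
by apply: contraL leGH => /(properG_ltn_log pG); rewrite ltnNge.
Qed.

(** * From pointwise to uniform conjugators *)

(** A proper subgroup of a p-group has at most 1/p of its elements, and
    all subgroups share 1; so p proper subgroups miss at least p - 1
    elements. *)
Lemma pgroup_cover (gT : finGroupType) (I : finType) (p : nat)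
    (K : {group gT}) (B : {set I}) (F : I -> {group gT}) :
  prime p -> p.-group K -> #|B| <= p ->
  (forall x, x \in K -> exists2 i, i \in B & x \in F i) ->
  exists2 i, i \in B & K \subset F i.
Proof.
move=> p_pr pK leBp covK.
have [/exists_inP[i Bi sKF]|] := boolP [exists i in B, K \subset F i].
  by exists i.
rewrite negb_exists_in => /forall_inP nsKF.
(* All pieces contain 1, so only the other elements are counted. *)
have leF i : i \in B -> (p * #|(K :&: F i)^#| + p <= #|K|)%N.
  move=> Bi; have := cardsD1 1 (K :&: F i).
  rewrite group1 addnC => E; rewrite addnC -mulnS -addn1 -E -(LagrangeI K (F i)).
  rewrite mulnC leq_pmul2l //.
  have ntK : #|K : F i| != 1%N by rewrite indexg_eq1 nsKF.
  have := dvdn_indexg K (F i); rewrite [X in _ %| X](card_pgroup pK).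
  case/(dvdn_pfactor _ _ p_pr)=> m _ Em; move: ntK; rewrite Em.
  by case: m {Em} => // m _; rewrite expnS leq_pmulr // expn_gt0 prime_gt0.
have leK : #|K^#| <= \sum_(i in B) #|(K :&: F i)^#|.
  have sKU : K^# \subset \bigcup_(i in B) (K :&: F i)^#.
    apply/subsetP=> x /setD1P[nt1x Kx]; have [i Bi Fix] := covK x Kx.
    by apply/bigcupP; exists i; rewrite // !inE nt1x Kx.
  apply: leq_trans (subset_leq_card sKU) _.
  elim/big_rec2: _ => [|i m U _ leUm]; first by rewrite cards0.
  by rewrite (leq_trans (leq_card_setU _ _)) // leq_add2l.
have: (\sum_(i in B) (p * #|(K :&: F i)^#| + p) <= \sum_(i in B) #|K|)%N.
  exact: leq_sum.
rewrite big_split /= -big_distrr !sum_nat_const /= => leS.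
have [i0 Bi0 _] := covK 1 (group1 K).
have := leF i0 Bi0; have := prime_gt1 p_pr; have := cardsD1 1 K.
have : 0 < #|B| by apply/card_gt0P; exists i0.
rewrite group1; move: leK leS leBp; set S := (\sum_(i in B) _)%N; clearbody S.
set k := #|K^#|; set n := #|B|; set c := #|_^#|; clearbody k n c.
rewrite add1n => leK leS leBp n_gt0 oK p_gt1 leFi0.
have lepK : p <= #|K| by apply: leq_trans leFi0; rewrite leq_addl.
have : (p * k <= p * (#|K| - p))%N.
  have lepS : (p * k <= p * S)%N by rewrite leq_mul2l leK orbT.
  rewrite (leq_trans _ (leq_mul leBp (leqnn _))) // mulnBr.
  rewrite -(leq_add2r (n * p)) subnK ?leq_mul2l ?lepK ?orbT //.
  by apply: leq_trans leS; rewrite leq_add2r.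
rewrite leq_pmul2l ?prime_gt0 // oK leq_subRL -?oK // oK.
by rewrite -add1n leq_add2r leqNgt p_gt1.
Qed.

Lemma Outc_eq1P (gT : finGroupType) (G : {group gT}) :
  Outc G = 1 <->
  forall a, a \in Autc G -> exists2 b, b \in G & {in G, forall x, a x = x ^ b}.
Proof.
have nIA: Autc G \subset 'N(Inn G) := normal_norm (Inn_normal G).
split=> [Out1 a Ga | allInn].
  have /subsetP/(_ a Ga): Autc G \subset Inn G.
    by rewrite -(quotient_sub1 nIA) -/(Outc G) Out1.
  case/morphimP=> b _ Gb ->; exists b => // x Gx; exact: conj_autE.
apply/trivgP; rewrite /Outc quotient_sub1 //; apply/subsetP=> a Aca.
have [Aa _] := AutcP Aca; have [b Gb ab] := allInn a Aca.
have ->: a = conj_aut G b.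
  apply: eq_Aut Aa _ _ => [|x Gx]; last by rewrite ab ?conj_autE.
  by rewrite (subsetP (Aut_conj_aut G G)) // mem_morphim ?(subsetP (normG G)).
by rewrite mem_morphim ?(subsetP (normG G)).
Qed.

Lemma conj_agreement (gT : finGroupType) (G : {group gT}) (a : {perm gT}) (b : gT) :
  a \in Aut G ->
  {K : {group gT} | forall x, (x \in K) = (x \in G) && (a x == x ^ b)}.
Proof.
move=> Aa; have gK : group_set [set x in G | a x == x ^ b].
  apply/group_setP; split=> [|x y].
    by rewrite inE group1 -(autmE Aa) morph1 conj1g /=.
  rewrite !inE => /andP[Gx /eqP ax] /andP[Gy /eqP ay]; rewrite groupM //=.
  by rewrite -(autmE Aa) morphM //= !autmE ax ay conjMg.
by exists (Group gK) => x; rewrite inE.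
Qed.

(** The points where an automorphism agrees with a given conjugation form a
    subgroup. So if every point of a p-group is dealt with by one of p
    conjugations, the covering lemma makes one of them work everywhere; this
    is how pointwise conjugators are turned into a single one. *)
Lemma uniform_conjugator (gT : finGroupType) (p : nat) (G H : {group gT})
    (a : {perm gT}) (B : {set gT}) :
  prime p -> p.-group H -> H \subset G -> a \in Aut G -> #|B| <= p ->
  {in H, forall x, exists2 b, b \in B & a x = x ^ b} ->
  exists2 b, b \in B & {in H, forall x, a x = x ^ b}.
Proof.
move=> p_pr pH sHG Aa leBp covH.
pose F b := sval (conj_agreement b Aa).
have FE b x : (x \in F b) = (x \in G) && (a x == x ^ b).
  exact: svalP (conj_agreement b Aa) x.
have [x Hx|b Bb sHF] := pgroup_cover (B := B) (F := F) p_pr pH leBp.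
  have [b Bb ax] := covH x Hx.
  by exists b => //; rewrite FE (subsetP sHG) // ax eqxx.
by exists b => // x /(subsetP sHF); rewrite FE => /andP[_ /eqP].
Qed.

(** * Abelian subgroups of index p *)

Lemma mul_index_p_cycle (gT : finGroupType) (p : nat) (G A : {group gT}) (g : gT) :
  prime p -> p.-group G -> A \subset G -> #|G : A| = p -> g \in G :\: A ->
  A * <[g]> = G.
Proof.
move=> p_pr pG sAG iAG /setDP[Gg notAg].
have maxA: maximal A G by apply: p_index_maximal; rewrite // iAG.
have [_ nAG] := andP (p_maximal_normal pG maxA).
rewrite -norm_joinEr ?cycle_subG ?(subsetP nAG) //.
have /maxgroupP[_ maxP] := maxA.
apply/eqP/idPn=> neqG; case/negP: notAg; rewrite -cycle_subG.
rewrite -(maxP (A <*> <[g]>)%G) ?joing_subr ?joing_subl //.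
by rewrite properEneq neqG join_subG sAG cycle_subG.
Qed.

(** Let g lie outside A, and let a class-preserving automorphism a send g to
    g ^ h. On the abelian group A a conjugation depends only on the coset of
    the conjugator modulo A, so a x is the conjugate of x by one of the p
    elements g^i h, and each of these sends g to g ^ h as well. One of them
    works on all of A, hence on A<g> = G. *)
Lemma Outc_abelian_index_p (gT : finGroupType) (p : nat) (G A : {group gT}) :
  prime p -> p.-group G -> A \subset G -> abelian A -> #|G : A| = p ->
  Outc G = 1.
Proof.
move=> p_pr pG sAG cAA iAG; apply/Outc_eq1P=> a Aca.
have [Aa ca] := AutcP Aca.
have [g Gg notAg]: exists2 g, g \in G & g \notin A.
  by apply/subsetPn; rewrite -indexg_eq1 iAG neq_ltn prime_gt1 ?orbT.
have defG: A * <[g]> = G.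
  by apply: mul_index_p_cycle p_pr pG sAG iAG _; rewrite inE notAg.
have sgG: <[g]> \subset G by rewrite cycle_subG.
have [h Gh ag] := ca g Gg.
(* Representatives are taken inside <[g]>, so that they commute with g. *)
pose B := [set repr C * h | C in rcosets (A :&: <[g]>) <[g]>].
have leBp: #|B| <= p.
  apply: leq_trans (leq_imset_card _ _) _.
  rewrite -/(#|_ : _|) setIC indexgI -iAG subset_leq_card //.
  apply/subsetP=> _ /rcosetsP[y gy ->]; apply/rcosetsP.
  by exists y; rewrite // (subsetP sgG).
have repB C : C \in rcosets (A :&: <[g]>) <[g]> -> exists i, repr C = g ^+ i.
  case/rcosetsP=> y gy ->.
  have := mem_repr_rcoset (A :&: <[g]>) y => /rcosetP[d /setIP[_ gd] ->].
  have /cycleP[i Ei]: d * y \in <[g]> by rewrite groupM.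
  by exists i.
have covA: {in A, forall x, exists2 b, b \in B & a x = x ^ b}.
  move=> x Ax; have [k Gk ->] := ca x (subsetP sAG x Ax).
  have: k * h^-1 \in A * <[g]> by rewrite defG groupM ?groupV.
  case/mulsgP=> u y Au gy /(canRL (mulgKV h)) ->.
  have Cy: (A :&: <[g]>) :* y \in rcosets (A :&: <[g]>) <[g]>.
    by apply/rcosetsP; exists y.
  exists (repr ((A :&: <[g]>) :* y) * h); first exact: imset_f.
  have := mem_repr_rcoset (A :&: <[g]>) y => /rcosetP[d /setIP[Ad _] ->].
  have fixA v: v \in A -> x ^ v = x.
    by move=> Av; rewrite /conjg (centsP cAA x Ax v Av) mulKg.
  by rewrite !conjgM (fixA u) ?(fixA d).
have [b Bb ab] := uniform_conjugator p_pr (pgroupS sAG pG) sAG Aa leBp covA.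
have [C Cc def_b] := imsetP Bb; have [i Ei] := repB C Cc.
have Gb: b \in G by rewrite def_b Ei groupM ?groupX.
exists b => //.
have [K defK] := conj_agreement b Aa.
have sGK: G \subset K.
  rewrite -defG mulG_subG cycle_subG; apply/andP; split.
    by apply/subsetP=> x Ax; rewrite defK (subsetP sAG) // ab ?eqxx.
  rewrite defK Gg ag def_b Ei conjgM; apply/eqP; congr (_ ^ h).
  by rewrite /conjg (commuteX i (commute_refl g)) mulKg.
by move=> x /(subsetP sGK); rewrite defK => /andP[_ /eqP].
Qed.

(** * Centres and centralisers in p-groups *)

Lemma pgroup_logn1_cyclic (gT : finGroupType) (p : nat) (G : {group gT}) :
  prime p -> p.-group G -> logn p #|G| <= 1 -> cyclic G.
Proof.
move=> p_pr pG; have := card_pgroup pG.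
case: (logn p #|G|) => [|[|//]] oG _; first by rewrite (card1_trivg oG) cyclic1.
by rewrite prime_cyclic // oG expn1.
Qed.

Lemma logn_center_nonabelian (gT : finGroupType) (p : nat) (G : {group gT}) :
  prime p -> p.-group G -> ~~ abelian G ->
  logn p #|'Z(G)| + 2 <= logn p #|G|.
Proof.
move=> p_pr pG; apply: contraR; rewrite -ltnNge (logn_Lagrange p (center_sub G)).
rewrite ltn_add2l ltnS => leQ; apply: cyclic_center_factor_abelian.
apply: (pgroup_logn1_cyclic p_pr); first exact: quotient_pgroup.
by rewrite card_quotient ?normal_norm ?center_normal.
Qed.

(** The centre of the centraliser of x contains both Z(G) and x, so its index
    is too small for a non-abelian group. *)
Lemma cent1_abelian (gT : finGroupType) (p : nat) (G : {group gT}) (x : gT) :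
  prime p -> p.-group G -> x \in G :\: 'Z(G) ->
  logn p #|'C_G[x]| <= logn p #|'Z(G)| + 2 -> abelian 'C_G[x].
Proof.
move=> p_pr pG /setDP[Gx notZx] leC; apply/idPn=> nabC.
have pC: p.-group 'C_G[x] := pgroupS (subsetIl _ _) pG.
have := logn_center_nonabelian p_pr pC nabC; apply/negP; rewrite -ltnNge.
apply: leq_ltn_trans leC _; rewrite ltn_add2r.
apply: properG_ltn_log (pgroupS (center_sub _) pC) _.
apply/properP; split; last first.
  exists x => //; rewrite inE inE Gx cent1id /=.
  by apply/centP=> y /setIP[_ /cent1P].
apply/subsetP=> z /setIP[Gz cGz]; apply/setIP; split.
  apply/setIP; split=> //.
  by apply/cent1P; apply: (centP cGz).
by apply: subsetP cGz; rewrite centS ?subsetIl.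
Qed.

(** The conjugates of x lie in the coset x N, so that there are at most #|N|
    of them. *)
Lemma logn_cent1 (gT : finGroupType) (p : nat) (G N : {group gT}) (x : gT) :
  prime p -> p.-group G -> p.-group N -> {in G, forall g, [~ x, g] \in N} ->
  logn p #|G| <= logn p #|'C_G[x]| + logn p #|N|.
Proof.
move=> p_pr pG pN xGN; rewrite (logn_Lagrange p (subsetIl G 'C[x])) leq_add2l.
have pI : p.-nat #|G : 'C_G[x]| := pnat_dvd (dvdn_indexg _ _) pG.
rewrite -(leq_exp2l _ _ (prime_gt1 p_pr)) -!p_part !part_pnat_id // index_cent1.
rewrite -(card_lcoset N x) subset_leq_card //.
apply/subsetP=> _ /imsetP[g Gg ->]; rewrite mem_lcoset.
by have := xGN g Gg.
Qed.

(** For y outside A, commutation with y is an endomorphism of A; its kernel is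
    Z(G), and its image is a normal subgroup modulo which y centralises A,
    that is, G'. *)
Lemma card_abelian_index_p (gT : finGroupType) (p : nat) (G A : {group gT}) :
  prime p -> p.-group G -> ~~ abelian G ->
  A \subset G -> abelian A -> #|G : A| = p ->
  #|G| = (#|G^`(1)| * #|'Z(G)| * p)%N.
Proof.
move=> p_pr pG nabG sAG cAA iAG; rewrite -(Lagrange sAG) iAG; congr (_ * _)%N.
have maxA: maximal A G by apply: p_index_maximal; rewrite // iAG.
have [_ nAG] := andP (p_maximal_normal pG maxA).
have genG y : y \in G -> y \notin A -> A * <[y]> = G.
  by move=> Gy notAy; apply: mul_index_p_cycle p_pr pG sAG iAG _; rewrite inE notAy.
have [y Gy notAy]: exists2 y, y \in G & y \notin A.
  by apply/subsetPn; rewrite -indexg_eq1 iAG neq_ltn prime_gt1 ?orbT.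
have nAy: y \in 'N(A) := subsetP nAG y Gy.
have fM: {in A &, {morph (fun a => [~ a, y]) : u v / u * v}}.
  move=> u v Au Av; have Auy: [~ u, y] \in A by rewrite groupM ?groupV ?memJ_norm.
  by rewrite commMgJ {1}/conjg (centsP cAA _ Auy _ Av) mulKg.
pose f := Morphism fM.
have fE u : f u = [~ u, y] by [].
have defZ : 'ker f = 'Z(G).
  apply/setP=> z; apply/idP/idP.
    move=> kz; have Az := dom_ker kz; have := mker kz; rewrite fE => /eqP/commgP czy.
    rewrite inE (subsetP sAG) //= -(genG y) // centM cent_cycle inE.
    by rewrite (subsetP cAA) //; apply/cent1P.
  case/setIP=> Gz /centP cz.
  have Az: z \in A.
    apply/idPn=> notAz; case/negP: nabG; rewrite -(genG z) //.
    rewrite abelianM cAA cycle_abelian /= cycle_subG.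
    by apply/centP=> u Au; apply: cz; apply: subsetP Au.
  by apply/kerP=> //; rewrite fE; apply/eqP/commgP; apply: cz.
have sfA: f @* A \subset A.
  apply/subsetP=> _ /morphimP[u _ Au ->]; rewrite fE.
  by rewrite groupM ?groupV ?memJ_norm.
have defG': f @* A = G^`(1).
  apply/eqP; rewrite eqEsubset; apply/andP; split.
    apply/subsetP=> _ /morphimP[u _ Au ->]; rewrite fE mem_commg //.
    exact: subsetP sAG u Au.
  have nfy: y \in 'N(f @* A).
    rewrite inE; apply/subsetP=> _ /imsetP[_ /morphimP[u _ Au ->] ->].
    have Auy: u ^ y \in A by rewrite memJ_norm.
    have ->: f u ^ y = f (u ^ y) by rewrite !fE conjRg [y ^ y]conjgE mulKg.
    exact: mem_morphim.
  have nfA: A \subset 'N(f @* A) by rewrite cents_norm // centsC (subset_trans sfA).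
  apply: der1_min; rewrite -(genG y) // ?mul_subG ?cycle_subG //.
  rewrite quotientMl // abelianM ?quotient_abelian ?cycle_abelian //=.
  rewrite quotient_cycle // cycle_subG -sub1set -quotient_set1 //.
  rewrite quotient_cents2r // gen_subG.
  apply/subsetP=> _ /imset2P[u v /set1P-> Av ->].
  by rewrite -invg_comm groupV -fE mem_morphim.
by rewrite -defG' -defZ card_morphim setIid mulnC Lagrange ?subsetIl.
Qed.

Lemma index_eq_prime (gT : finGroupType) (p : nat) (G H : {group gT}) :
  p.-group G -> H \subset G -> logn p #|G| = (logn p #|H| + 1)%N ->
  #|G : H| = p.
Proof.
move=> pG sHG; rewrite (logn_Lagrange p sHG) => /addnI lgI.
have pI : p.-nat #|G : H| := pnat_dvd (dvdn_indexg _ _) pG.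
by rewrite -(part_pnat_id pI) p_part lgI expn1.
Qed.

Lemma center_proper_cent1 (gT : finGroupType) (G : {group gT}) (x : gT) :
  x \in G :\: 'Z(G) -> 'Z(G) \proper 'C_G[x].
Proof.
case/setDP=> Gx notZx; apply/properP; split; last first.
  by exists x; rewrite // inE Gx cent1id.
by rewrite setIS // -cent_set1 centS ?sub1set.
Qed.

Lemma cent1_proper (gT : finGroupType) (G : {group gT}) (x : gT) :
  x \in G :\: 'Z(G) -> 'C_G[x] \proper G.
Proof.
case/setDP=> Gx notZx; rewrite properEneq subsetIl andbT.
apply: contra notZx => /eqP/setIidPl sGC; rewrite inE Gx.
by rewrite -sub_cent1.
Qed.

Lemma logn_cent1_bounds (gT : finGroupType) (p : nat) (G : {group gT}) (x : gT) :
  p.-group G -> x \in G :\: 'Z(G) ->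
  logn p #|'Z(G)| < logn p #|'C_G[x]| < logn p #|G|.
Proof.
move=> pG GZx; rewrite (properG_ltn_log pG (cent1_proper GZx)) andbT.
apply: properG_ltn_log (center_proper_cent1 GZx).
exact: pgroupS (subsetIl _ _) pG.
Qed.

Lemma nonabelian_noncentral (gT : finGroupType) (G : {group gT}) :
  ~~ abelian G -> exists x, x \in G :\: 'Z(G).
Proof.
move=> nabG; apply/set0Pn; rewrite setD_eq0; apply: contra nabG => sGZ.
exact: abelianS sGZ (center_abelian G).
Qed.

(** The centraliser of a non-central element is an abelian subgroup of index
    p, so that |G| = |G'| |Z(G)| p. *)
Lemma card_der1_center_index_p2 (gT : finGroupType) (p : nat) (G : {group gT}) :
  prime p -> p.-group G -> ~~ abelian G ->
  logn p #|G| = (logn p #|'Z(G)| + 2)%N -> #|G^`(1)| = p.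
Proof.
move=> p_pr pG nabG lgG.
have [x GZx] := nonabelian_noncentral nabG.
have /andP[ltZC ltCG] := logn_cent1_bounds pG GZx.
have cCC: abelian 'C_G[x] by apply: (cent1_abelian p_pr pG GZx); lia.
have iCG: #|G : 'C_G[x]| = p.
  by apply: (index_eq_prime pG (subsetIl _ _)); card_lia.
have := card_abelian_index_p p_pr pG nabG (subsetIl _ _) cCC iCG.
move/(congr1 (logn p)); rewrite !lognM ?muln_gt0 ?cardG_gt0 ?prime_gt0 //.
rewrite (pfactorK 1) // => lgG'.
have lgG'1 : logn p #|G^`(1)| = 1%N by card_lia.
by rewrite (card_pgroup (pgroupS (der_sub 1 G) pG)) lgG'1 expn1.
Qed.

(** If the centre had order p, every class would have at most p elements, so
    the common centraliser K of two non-commuting elements x and y would have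
    order p ^ 2. Then K is abelian and is a maximal subgroup of C(x), which in
    turn is maximal in G; so K together with x and y generates G, and K is
    central, which is absurd. *)
Lemma logn_center_class2_p4 (gT : finGroupType) (p : nat) (G : {group gT}) :
  prime p -> p.-group G -> logn p #|G| = 4 -> G^`(1) \subset 'Z(G) ->
  1 < logn p #|'Z(G)|.
Proof.
move=> p_pr pG lgG sG'Z.
have [cGG | nabG] := boolP (abelian G); first by rewrite (center_idP cGG) lgG.
rewrite ltnNge; apply/negP=> leZ1.
have [x GZx] := nonabelian_noncentral nabG.
have Gx: x \in G by case/setDP: GZx.
have pZ: p.-group 'Z(G) := pgroupS (center_sub G) pG.
have /properP[_ [y Gy notCxy]] := cent1_proper GZx.
have pCx: p.-group 'C_G[x] := pgroupS (subsetIl G 'C[x]) pG.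
have lgCx: 3 <= logn p #|'C_G[x]|.
  have: {in G, forall g, [~ x, g] \in 'Z(G)}.
    by move=> g Gg; rewrite (subsetP sG'Z) ?mem_commg.
  by move/(logn_cent1 p_pr pG pZ); rewrite lgG; card_lia.
have [K defK]: exists K : {group gT}, K :=: 'C_('C_G[x])[y].
  by exists 'C_('C_G[x])[y]%G.
have lgK: 2 <= logn p #|K|.
  have: {in 'C_G[x], forall g, [~ y, g] \in 'Z(G)}.
    by move=> g /setIP[Gg _]; rewrite (subsetP sG'Z) ?mem_commg.
  by move/(logn_cent1 p_pr pCx pZ); rewrite -defK; card_lia.
have sKC: K \subset 'C_G[x] by rewrite defK subsetIl.
have sKy: K \subset 'C[y] by rewrite defK subsetIr.
have sKG: K \subset G := subset_trans sKC (subsetIl _ _).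
have notKx: x \notin K.
  by apply: contra notCxy => /(subsetP sKy) cyx; rewrite inE Gy cent1C.
have ltKC: logn p #|K| < logn p #|'C_G[x]|.
  apply: properG_ltn_log pCx _; apply/properP; split=> //.
  by exists x => //; rewrite inE Gx cent1id.
have /andP[_ ltCG] := logn_cent1_bounds pG GZx.
have cKK: abelian K by apply: (p2group_abelian (pgroupS sKG pG)); card_lia.
(* C(K) contains K and x, hence all of C(x). *)
have sCL: 'C_G[x] \subset 'C(K).
  apply/setIidPl; apply: (pgroup_logn_subset_eq (G := 'C_G[x]) (p := p)) => //.
    exact: subsetIl.
  suff: logn p #|K| < logn p #|'C_G[x] :&: 'C(K)| by card_lia.
  apply: properG_ltn_log (pgroupS (subsetIl _ _) pCx) _; apply/properP; split.
    by rewrite subsetI sKC.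
  exists x => //; rewrite inE inE Gx cent1id /=.
  by rewrite -sub_cent1 (subset_trans sKC) // subsetIr.
(* C(K) contains C(x) and y, hence all of G. *)
have sGL: G \subset 'C(K).
  apply/setIidPl; apply: (pgroup_logn_subset_eq (G := G) (p := p)) => //.
    exact: subsetIl.
  suff: logn p #|'C_G[x]| < logn p #|G :&: 'C(K)| by card_lia.
  apply: properG_ltn_log (pgroupS (subsetIl _ _) pG) _; apply/properP; split.
    by rewrite subsetI subsetIl.
  by exists y => //; rewrite inE Gy -sub_cent1.
have: logn p #|K| <= logn p #|'Z(G)|.
  by rewrite dvdn_leq_log ?cardG_gt0 // cardSg // subsetI sKG centsC.
card_lia.
Qed.

(** * Counting class-preserving automorphisms *)

(** One half of the Burnside basis theorem: lifts of generators of the Frattini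
    quotient generate G. *)
Lemma grank_leq_Phi (gT : finGroupType) (p : nat) (G : {group gT}) :
  p.-group G -> 'm(G) <= logn p #|G / 'Phi(G)|.
Proof.
move=> pG; have abQ := Phi_quotient_abelem pG.
rewrite -rank_abelem // -grank_abelian; last by case/and3P: abQ.
have [B genB <-] := grank_witness (G / 'Phi(G)).
have sPG := Phi_sub G; have nPG := normal_norm (Phi_normal G).
pose X := (fun C : coset_of 'Phi(G) => repr C) @: B.
suff genX : <<X>> = G.
  apply: leq_trans (leq_imset_card _ B : #|X| <= _).
  by rewrite -[G in 'm(G)]genX grank_min.
have NX b : b \in B -> (repr b \in G) * (coset 'Phi(G) (repr b) = b).
  move=> Bb; have Qb: b \in G / 'Phi(G) by rewrite -genB mem_gen.
  split; last exact: coset_reprK.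
  rewrite -sub1set -(quotientSGK _ sPG) ?sub1set ?repr_coset_norm //.
  by rewrite quotient_set1 ?repr_coset_norm // coset_reprK sub1set.
apply: Phi_nongen; apply/eqP; rewrite eqEsubset join_subG sPG /=.
apply/andP; split; first by apply/subsetP=> _ /imsetP[b Bb ->]; case: (NX b Bb).
rewrite -(quotientSGK nPG) ?joing_subl // -genB gen_subG.
apply/subsetP=> b Bb; rewrite -(NX b Bb).2 mem_quotient //.
by apply: (subsetP (joing_subr _ _)); apply/imsetP; exists b.
Qed.

(** A class-preserving automorphism a is determined by the elements
    x^-1 * a x of G' for x in a generating set. *)
Lemma card_Autc_leq (gT : finGroupType) (G : {group gT}) :
  #|Autc G| <= #|G^`(1)| ^ 'm(G).
Proof.
have [X genX <-] := grank_witness G.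
have sXG: X \subset G by rewrite -genX subset_gen.
pose f (a : {perm gT}) := [ffun x => if x \in X then x^-1 * a x else 1].
have injf: {in Autc G &, injective f}.
  move=> a b /AutcP[Aa _] /AutcP[Ab _] /ffunP eq_f.
  pose c := a * b^-1; have Ac : c \in Aut G by rewrite groupM ?groupV.
  have [K defK] := conj_agreement 1 Ac.
  apply: eq_Aut Aa Ab _ => x; rewrite -{1}genX => /(subsetP _).
  have sXK: <<X>> \subset K.
    rewrite gen_subG; apply/subsetP=> x1 Xx; rewrite defK (subsetP sXG) //= conjg1 permM.
    by move: (eq_f x1); rewrite !ffunE Xx => /mulgI->; rewrite permK.
  move/(_ _ sXK); rewrite defK conjg1 permM => /andP[_ /eqP {2}<-].
  by rewrite permKV.
have sfX : f @: Autc G \subset pffun_on 1 X G^`(1).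
  apply/subsetP=> _ /imsetP[a /AutcP[Aa ca] ->].
  apply/pffun_onP; split=> [|_ /imageP[x /= Xx ->]].
    by apply/subsetP=> x; apply: contraNT => /[!ffunE]/negPf->.
  have Gx := subsetP sXG x Xx; have [g Gg axg] := ca x Gx.
  by rewrite ffunE Xx axg; exact: (mem_commg Gx Gg).
rewrite -(card_in_imset injf) -(card_pffun_on (1 : gT)).
exact: subset_leq_card sfX.
Qed.

Lemma Outc_eq1_card (gT : finGroupType) (G : {group gT}) :
  #|G^`(1)| ^ 'm(G) <= #|G : 'Z(G)| -> Outc G = 1.
Proof.
move=> leZ; have oI : #|Inn G| = #|G : 'Z(G)|.
  rewrite /Inn card_morphim ker_conj_aut.
  by rewrite (setIidPr (normG G)) -indexgI.
have [sIA nIA] := andP (Inn_normal G).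
apply/trivgP; rewrite /Outc quotient_sub1 //.
have: Inn G == Autc G by rewrite eqEcard sIA oI (leq_trans (card_Autc_leq G)).
by rewrite eqEsubset => /andP[].
Qed.

(** * Central automorphisms *)

(** The quotient G / M and the centre are cyclic of the same prime order, so
    there is a homomorphism f from G onto Z(G) with kernel M; the automorphism
    is x |-> x * f x, injective because f kills the centre. *)
Lemma central_automorphism (gT : finGroupType) (p : nat) (G M : {group gT}) :
  prime p -> p.-group G -> M \subset G -> #|G : M| = p ->
  #|'Z(G)| = p -> 'Z(G) \subset M ->
  exists2 a, a \in Aut G &
    {in M, forall x, a x = x}
    /\ {in G :\: M, forall x, exists2 z, z \in 'Z(G)^# & a x = x * z}.
Proof.
move=> p_pr pG sMG iMG oZ sZM.
have maxM: maximal M G by apply: p_index_maximal; rewrite // iMG.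
have [_ nMG] := andP (p_maximal_normal pG maxM).
have /subsetPn[g Gg notMg]: ~~ (G \subset M).
  by rewrite -indexg_eq1 iMG neq_ltn prime_gt1 ?orbT.
have /cyclicP[z defZ]: cyclic 'Z(G) by rewrite prime_cyclic ?oZ.
have oz: #[z] = p by rewrite orderE -defZ.
have Zz: z \in 'Z(G) by rewrite defZ cycle_id.
have oQ: #|G / M| = p by rewrite card_quotient.
have Qg: coset M g \in G / M by rewrite mem_quotient.
have ntg: coset M g != 1.
  by apply: contra notMg => /eqP/coset_idr->; rewrite ?(subsetP nMG).
have og: #[coset M g] = p by apply: nt_prime_order => //; rewrite -oQ expg_cardG.
have defQ: <[coset M g]> = G / M.
  by apply/eqP; rewrite eqEcard cycle_subG Qg -orderE og oQ leqnn.
have dvd_zg: #[z] %| #[coset M g] by rewrite oz og.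
pose h := eltm dvd_zg.
have injh : 'injm (eltm_morphism dvd_zg) by rewrite injm_eltm oz og.
have Zh u : u \in G -> h (coset M u) \in 'Z(G).
  move=> Gu; have : coset M u \in <[coset M g]> by rewrite defQ mem_quotient.
  by case/cycleP=> i ->; rewrite /h eltmE groupX.
have hM : {in G &, forall u v, h (coset M (u * v)) = h (coset M u) * h (coset M v)}.
  move=> u v Gu Gv; rewrite morphM ?(subsetP nMG) //=.
  by rewrite /h eltmM ?defQ ?mem_quotient.
have h1 u : u \in M -> h (coset M u) = 1.
  by move=> Mu; rewrite coset_id // /h (morph1 (eltm_morphism dvd_zg)).
have fM : {in G &, {morph (fun u => u * h (coset M u)) : u v / u * v}}.
  move=> u v Gu Gv /=; rewrite hM // -!mulgA; congr (_ * _); rewrite !mulgA.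
  by congr (_ * _); have /setIP[_ /centP->] := Zh u Gu.
pose f := Morphism fM.
have injf : 'injm f.
  apply/subsetP=> u /morphpreP[Gu /set1P /= fu1].
  have Mu: u \in M.
    rewrite (canRL (mulgK _) fu1) mul1g groupV (subsetP sZM) ?Zh //.
  by move: fu1; rewrite h1 // mulg1 => ->; rewrite inE.
have fG : f @* G = G.
  apply/eqP; rewrite eqEcard card_injm // leqnn andbT.
  apply/subsetP=> _ /morphimP[u _ Gu ->] /=.
  by rewrite groupM // (subsetP (center_sub G)) ?Zh.
exists (aut injf fG); first exact: Aut_aut.
split=> [x Mx | x /setDP[Gx notMx]].
  by rewrite autE ?(subsetP sMG) //= h1 ?mulg1.
exists (h (coset M x)); last by rewrite autE.
apply/setD1P; split; last exact: Zh.
apply: contra notMx => /eqP hx1.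
have cx : coset M x = 1.
  apply: (injmP injh) (group1 _) _ => /=; first by rewrite defQ mem_quotient.
  by rewrite -/h hx1 /h (morph1 (eltm_morphism dvd_zg)).
by rewrite coset_idr ?(subsetP nMG).
Qed.

(** * The second centre *)

Lemma ucn2P (gT : finGroupType) (G : {group gT}) (x : gT) :
  reflect (x \in G /\ {in G, forall g, [~ x, g] \in 'Z(G)}) (x \in 'Z_2(G)).
Proof.
rewrite ucnSnR inE ucn1; apply: (iffP andP) => -[Gx xG]; split=> //.
  by move=> g Gg; rewrite (subsetP xG) // mem_commg ?set11.
by rewrite gen_subG; apply/subsetP=> _ /imset2P[_ g /set1P-> Gg ->]; apply: xG.
Qed.

Lemma nil_class_leq3 (gT : finGroupType) (G : {group gT}) :
  nilpotent G -> (nil_class G <= 3) = (G^`(1) \subset 'Z_2(G)).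
Proof.
move=> nilG; apply/(ucn_nil_classP 3 nilG)/idP=> [defG | sG'Z].
  by have := ucn_comm 2 G; rewrite defG.
apply/eqP; rewrite eqEsubset ucn_sub /=; apply/subsetP=> x Gx.
rewrite ucnSnR inE Gx (subset_trans _ sG'Z) //.
by rewrite commSg // sub1set.
Qed.

Lemma logn_ucn2 (gT : finGroupType) (p : nat) (G : {group gT}) :
  logn p #|'Z_2(G)| = (logn p #|'Z(G)| + logn p #|'Z(G / 'Z(G))|)%N.
Proof.
have sZ: 'Z(G) \subset 'Z_2(G) by rewrite -ucn1 ucn_subS.
have nZ: 'Z_2(G) \subset 'N('Z(G)).
  exact: subset_trans (ucn_sub 2 G) (normal_norm (center_normal G)).
rewrite (logn_Lagrange p sZ) -card_quotient //; congr (_ + logn p _)%N.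
by have := ucn_central 1 G; rewrite ucn1 => <-.
Qed.

(** Three subgroups lemma applied to G, G and the second centre. *)
Lemma ucn2_cent_der1 (gT : finGroupType) (G : {group gT}) :
  G^`(1) \subset 'C('Z_2(G)).
Proof.
have c1 : [~: 'Z_2(G), G, G] = 1.
  apply/commG1P; apply: subset_trans (ucn_comm 1 G) _.
  by rewrite ucn1 subsetIr.
apply/commG1P/three_subgroup=> //.
by rewrite [[~: G, 'Z_2(G)]]commGC.
Qed.

(** * Commutators covering the centre *)

(** Powers of d multiply the central commutator up to all of its powers, and any
    nontrivial element of a group of prime order generates it. *)
Lemma center_sub_commutators (gT : finGroupType) (p : nat) (G : {group gT}) (x d : gT) :
  prime p -> #|'Z(G)| = p -> d \in G -> [~ x, d] \in 'Z(G) -> [~ x, d] != 1 ->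
  'Z(G) \subset [set [~ x, g] | g in G].
Proof.
move=> p_pr oZ Gd Zxd ntxd.
have defZ: <[ [~ x, d] ]> = 'Z(G).
  apply/eqP; rewrite eqEcard cycle_subG Zxd oZ -orderE dvdn_leq //.
  have := order_dvdG Zxd; rewrite oZ; case/primeP: p_pr => _ dvdp /dvdp.
  by rewrite order_eq1 (negPf ntxd) => /eqP->.
rewrite -defZ; apply/subsetP=> _ /cycleP[i ->].
apply/imsetP; exists (d ^+ i); rewrite ?groupX //.
have /setIP[_ /centP cxd] := Zxd.
by rewrite commgX //; apply/commute_sym/cxd.
Qed.

(** The contrapositive of the previous lemma applied to every d at once. It is
    applied with d in the second centre, where all commutators are central. *)
Lemma uncovered_element (gT : finGroupType) (p : nat) (G : {group gT}) (x : gT) :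
  prime p -> #|'Z(G)| = p -> 'Z(G) \subset G^`(1) -> x \in G :\: G^`(1) ->
  ~~ ('Z(G) \subset [set [~ x, g] | g in G]) ->
  [/\ {in G, forall d, [~ x, d] \in 'Z(G) -> [~ x, d] = 1},
      x \notin 'Z_2(G) & x \in 'C('Z_2(G))].
Proof.
move=> p_pr oZ sZG' /setDP[Gx notG'x] notcov.
have cx : {in G, forall d, [~ x, d] \in 'Z(G) -> [~ x, d] = 1}.
  move=> d Gd Zxd; apply: contraNeq notcov.
  exact: center_sub_commutators p_pr oZ Gd Zxd.
split=> //.
  have : x \notin 'Z(G) by apply: contra notG'x; apply: subsetP.
  apply: contra => /ucn2P[_ xG]; rewrite inE Gx.
  by apply/centP=> d Gd; apply/commgP; rewrite cx ?xG.
apply/centP=> d /ucn2P[Gd dG]; apply/commgP; rewrite cx //.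
by rewrite -invg_comm groupV dG.
Qed.

(** Take a maximal subgroup M that does not contain the centraliser of Z_2(G),
    and a central automorphism x |-> x * f x with kernel of f equal to M. It
    is class-preserving because each f x is a commutator [x, g]. A conjugation
    by b with the same effect has all [x, b] central, so b is in Z_2(G); then
    it fixes an element of the centraliser of Z_2(G) outside M, which the
    automorphism moves. *)
Lemma Outc_neq1_of_covered_center (gT : finGroupType) (p : nat) (G : {group gT}) :
  prime p -> p.-group G -> #|'Z(G)| = p -> 'Z(G) \subset G^`(1) ->
  {in G :\: G^`(1), forall x, 'Z(G) \subset [set [~ x, g] | g in G]} ->
  ~~ ('C_G('Z_2(G)) \subset 'Phi(G)) -> Outc G <> 1.
Proof.
move=> p_pr pG oZ sZG' covZ notCPhi /Outc_eq1P allInn.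
have /exists_inP[M maxM notCM]:
    [exists (M : {group gT} | maximal_eq M G), ~~ ('C_G('Z_2(G)) \subset M)].
  apply: contraR notCPhi; rewrite negb_exists_in => /forall_inP sCM.
  by apply/bigcapsP=> M maxM; move: (sCM M maxM); rewrite negbK.
have {}maxM : maximal M G.
  case/predU1P: maxM => // defM.
  by rewrite defM subsetIl in notCM.
have nsMG := p_maximal_normal pG maxM; have [sMG nMG] := andP nsMG.
have iMG := p_maximal_index pG maxM.
have sG'M : G^`(1) \subset M.
  apply: der1_min => //; apply/cyclic_abelian/prime_cyclic.
  by rewrite card_quotient ?iMG.
have sZM := subset_trans sZG' sG'M.
have [a Aa [aM aGM]] := central_automorphism p_pr pG sMG iMG oZ sZM.
have Aca : a \in Autc G.
  apply/AutcP; split=> // x Gx.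
  have [Mx | notMx] := boolP (x \in M); first by exists 1; rewrite ?conjg1 ?aM.
  have [|z /setD1P[_ Zz] ->] := aGM x; first by rewrite inE notMx.
  have /covZ/subsetP/(_ z Zz)/imsetP[g Gg ->]: x \in G :\: G^`(1).
    by rewrite inE Gx (contra (subsetP sG'M x)).
  by exists g; rewrite // conjg_mulR.
have [b Gb ab] := allInn a Aca.
have Z2b : b \in 'Z_2(G).
  apply/ucn2P; split=> // x Gx; rewrite -groupV invg_comm commgEl -ab //.
  have [Mx | notMx] := boolP (x \in M); first by rewrite aM // mulVg group1.
  have [|z /setD1P[_ Zz] ->] := aGM x; first by rewrite inE notMx.
  by rewrite mulKg.
case/subsetPn: notCM => c /setIP[Gc /centP cZc] notMc.
have [|z /setD1P[ntz Zz]] := aGM c; first by rewrite inE notMc.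
rewrite ab // /conjg (cZc b Z2b) mulKg => /eqP.
by rewrite -{1}[c]mulg1 => /eqP/mulgI/esym/eqP; rewrite (negPf ntz).
Qed.

(** * Order p^5 with centre of order p *)

(** The central quotient has order p ^ 4 and class 2, so its centre has order
    p ^ 2 exactly and its derived subgroup has order p. *)
Lemma class3_p5_logn (gT : finGroupType) (p : nat) (G : {group gT}) :
  prime p -> p.-group G -> logn p #|G| = 5 -> logn p #|'Z(G)| = 1%N ->
  'Z(G) \subset G^`(1) -> nil_class G = 3 ->
  logn p #|'Z_2(G)| = 3 /\ logn p #|G^`(1)| = 2.
Proof.
move=> p_pr pG lgG lgZ sZG' clG.
have nZG := normal_norm (center_normal G); have sZG := center_sub G.
have pQ : p.-group (G / 'Z(G)) by apply: quotient_pgroup.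
have clQ : nil_class (G / 'Z(G)) = 2.
  by rewrite nil_class_quotient_center ?(pgroup_nil pG) // clG.
have lgQ : logn p #|G / 'Z(G)| = 4.
  have := logn_Lagrange p sZG; rewrite -card_quotient //; card_lia.
have nabQ : ~~ abelian (G / 'Z(G)) by rewrite -nil_class1 clQ.
have lgZQ : 1 < logn p #|'Z(G / 'Z(G))|.
  by apply: logn_center_class2_p4 p_pr pQ lgQ _; rewrite -nil_class2 clQ.
have lgZQ' := logn_center_nonabelian p_pr pQ nabQ.
split; first by rewrite (logn_ucn2 p G); card_lia.
have oQ' : #|(G / 'Z(G))^`(1)| = p.
  by apply: card_der1_center_index_p2 p_pr pQ nabQ _; card_lia.
have := logn_Lagrange p sZG'; rewrite -card_quotient; last first.
  exact: subset_trans (der_sub 1 G) nZG.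
by rewrite quotient_der // oQ' (logn_prime p p_pr) eqxx lgZ.
Qed.

Lemma center_lt_ucn2 (gT : finGroupType) (p : nat) (G : {group gT}) :
  p.-group G -> ~~ abelian G -> logn p #|'Z(G)| < logn p #|'Z_2(G)|.
Proof.
move=> pG nabG; have pQ : p.-group (G / 'Z(G)) by apply: quotient_pgroup.
rewrite logn_ucn2 -[X in X < _]addn0 ltn_add2l.
rewrite -(logn1 p) -(cards1 (1 : coset_of 'Z(G))).
have pZQ : p.-group 'Z(G / 'Z(G)) := pgroupS (center_sub _) pQ.
apply: properG_ltn_log pZQ _ => /=.
rewrite proper1G; apply: contra nabG => /eqP Z1.
have: G / 'Z(G) = 1 by apply/eqP; rewrite -(center_nil_eq1 (pgroup_nil pQ)) Z1.
move=> Q1; apply: cyclic_center_factor_abelian; rewrite Q1; exact: cyclic1.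
Qed.

(** Otherwise G / Z_2(G) would have order at most p ^ 2 and be abelian, which
    would force class at most 3. *)
Lemma class4_p5_logn_ucn2 (gT : finGroupType) (p : nat) (G : {group gT}) :
  prime p -> p.-group G -> logn p #|G| = 5 -> logn p #|'Z(G)| = 1%N ->
  nil_class G = 4 -> logn p #|'Z_2(G)| = 2.
Proof.
move=> p_pr pG lgG lgZ clG.
have nabG : ~~ abelian G by rewrite -nil_class1 clG.
have := center_lt_ucn2 pG nabG; rewrite lgZ => lt1Z2.
apply/eqP; rewrite eqn_leq lt1Z2 andbT leqNgt; apply/negP=> lt2Z2.
suff: nil_class G <= 3 by rewrite clG.
rewrite (nil_class_leq3 (pgroup_nil pG)); apply: der1_min; first exact: ucn_norm.
apply: (p2group_abelian (p := p)); first exact: quotient_pgroup.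
have := logn_Lagrange p (ucn_sub 2 G); rewrite -card_quotient ?ucn_norm //.
card_lia.
Qed.

(** Here Z_2(G) is generated by Z(G) and one element b, all of whose commutators
    are central. *)
Lemma logn_cent_ucn2 (gT : finGroupType) (p : nat) (G : {group gT}) :
  prime p -> p.-group G -> ~~ abelian G ->
  logn p #|'Z_2(G)| = (logn p #|'Z(G)| + 1)%N ->
  logn p #|G| <= logn p #|'C_G('Z_2(G))| + logn p #|'Z(G)|.
Proof.
move=> p_pr pG nabG lgZ2.
have sZ2G := ucn_sub 2 G.
have sZZ2: 'Z(G) \subset 'Z_2(G) by rewrite -ucn1 ucn_subS.
have pZ2 : p.-group 'Z_2(G) := pgroupS sZ2G pG.
have pZ : p.-group 'Z(G) := pgroupS (center_sub G) pG.
have iZ : #|'Z_2(G) : 'Z(G)| = p by apply: index_eq_prime; rewrite ?sZZ2 //= lgZ2.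
have /subsetPn[b Z2b notZb]: ~~ ('Z_2(G) \subset 'Z(G)).
  by rewrite -indexg_eq1 iZ neq_ltn prime_gt1 ?orbT.
have defZ2 : 'Z(G) * <[b]> = 'Z_2(G).
  by apply: (mul_index_p_cycle p_pr pZ2 sZZ2 iZ); rewrite inE notZb.
have -> : 'C_G('Z_2(G)) = 'C_G[b].
  rewrite -defZ2 centM cent_cycle setIA; congr (_ :&: _).
  by apply/setIidPl; rewrite centsC subsetIr.
have [Gb bG] := ucn2P _ _ Z2b.
exact: logn_cent1 p_pr pG pZ bG.
Qed.

Lemma center_sub_der1 (gT : finGroupType) (p : nat) (G : {group gT}) :
  p.-group G -> ~~ abelian G -> prime #|'Z(G)| -> 'Z(G) \subset G^`(1).
Proof.
move=> pG nabG prZ.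
have := meet_center_nil (pgroup_nil pG) (der_normal 1 G).
case: (prime_subgroupVti [group of G^`(1)] prZ) => // -> /(_ _)/eqP[] //.
by apply: contra nabG => /eqP G'1; rewrite /abelian; apply/commG1P.
Qed.

(** If x outside G' failed to cover the centre, x would centralise Z_2(G),
    which is abelian of order p ^ 3; so <x> Z_2(G) would be abelian of index p
    and force G' to have order p ^ 3 instead of p ^ 2. The second centre
    centralises itself and is larger than the Frattini subgroup, of order at
    most p ^ 2 as there are three generators. *)
Lemma Outc_neq1_class3 (gT : finGroupType) (p : nat) (G : {group gT}) :
  prime p -> p.-group G -> logn p #|G| = 5 -> #|'Z(G)| = p ->
  nil_class G = 3 -> 'm(G) = 3 -> Outc G <> 1.
Proof.
move=> p_pr pG lgG oZ clG mG.
have lgZ: logn p #|'Z(G)| = 1%N by rewrite oZ (logn_prime p p_pr) eqxx.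
have nabG : ~~ abelian G by rewrite -nil_class1 clG.
have sZG' : 'Z(G) \subset G^`(1) by apply: center_sub_der1 pG nabG _; rewrite oZ.
have [lgZ2 lgG'] := class3_p5_logn p_pr pG lgG lgZ sZG' clG.
have sZ2G := ucn_sub 2 G; have pZ2 : p.-group 'Z_2(G) := pgroupS sZ2G pG.
have sG'Z2 : G^`(1) \subset 'Z_2(G) by rewrite -(nil_class_leq3 (pgroup_nil pG)) clG.
have cZ2 : abelian 'Z_2(G).
  apply/idPn=> /(logn_center_nonabelian p_pr pZ2); rewrite lgZ2.
  have : logn p #|G^`(1)| <= logn p #|'Z('Z_2(G))|.
    rewrite dvdn_leq_log ?cardG_gt0 // cardSg // subsetI sG'Z2.
    exact: ucn2_cent_der1.
  card_lia.
apply: (Outc_neq1_of_covered_center p_pr pG oZ sZG').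
  move=> x GG'x; apply/idPn=> notcov.
  have [_ notZ2x cxZ2] := uncovered_element p_pr oZ sZG' GG'x notcov.
  have /setDP[Gx _] := GG'x.
  have [M defM] : exists M : {group gT}, M :=: 'Z_2(G) <*> <[x]>.
    by exists ('Z_2(G) <*> <[x]>)%G.
  have sMG : M \subset G by rewrite defM join_subG sZ2G cycle_subG.
  have pM : p.-group M := pgroupS sMG pG.
  have cMM : abelian M.
    by rewrite defM abelianY cZ2 cycle_abelian cycle_subG.
  have ltZM : logn p #|'Z_2(G)| < logn p #|M|.
    apply: properG_ltn_log pM _; rewrite defM; apply/properP.
    split; first exact: joing_subl.
    by exists x => //; rewrite (subsetP (joing_subr _ _)) ?cycle_id.
  have ltMG : logn p #|M| < logn p #|G|.
    apply: properG_ltn_log pG _; rewrite properEneq sMG andbT.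
    by apply: contra nabG => /eqP <-.
  have iM : #|G : M| = p by apply: index_eq_prime pG sMG _; card_lia.
  have := card_abelian_index_p p_pr pG nabG sMG cMM iM.
  move/(congr1 (logn p)); rewrite !lognM ?muln_gt0 ?cardG_gt0 ?prime_gt0 //.
  by rewrite (pfactorK 1) // lgG lgG' lgZ.
apply/negP=> sCPhi.
have lePhi : logn p #|'Z_2(G)| <= logn p #|'Phi(G)|.
  rewrite dvdn_leq_log ?cardG_gt0 // cardSg // (subset_trans _ sCPhi) //.
  by rewrite subsetI sZ2G.
have := logn_Lagrange p (Phi_sub G); rewrite -card_quotient ?gFnorm //.
have := grank_leq_Phi pG; rewrite mG; card_lia.
Qed.

(** Here Z_2(G) has order p ^ 2, so its centraliser has index p in G, whereas
    the Frattini subgroup of a non-cyclic p-group has index at least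
    p ^ 2. *)
Lemma Outc_neq1_class4 (gT : finGroupType) (p : nat) (G : {group gT}) :
  prime p -> p.-group G -> logn p #|G| = 5 -> #|'Z(G)| = p ->
  nil_class G = 4 ->
  {in G :\: G^`(1), forall x, 'Z(G) \subset [set [~ x, g] | g in G]} ->
  Outc G <> 1.
Proof.
move=> p_pr pG lgG oZ clG covZ.
have lgZ: logn p #|'Z(G)| = 1%N by rewrite oZ (logn_prime p p_pr) eqxx.
have nabG : ~~ abelian G by rewrite -nil_class1 clG.
have sZG' : 'Z(G) \subset G^`(1) by apply: center_sub_der1 pG nabG _; rewrite oZ.
have lgZ2 := class4_p5_logn_ucn2 p_pr pG lgG lgZ clG.
apply: (Outc_neq1_of_covered_center p_pr pG oZ sZG' covZ); apply/negP=> sCPhi.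
have leC : logn p #|G| <= logn p #|'C_G('Z_2(G))| + logn p #|'Z(G)|.
  by apply: logn_cent_ucn2 => //; rewrite lgZ2 lgZ.
have lePhi : logn p #|'C_G('Z_2(G))| <= logn p #|'Phi(G)|.
  by rewrite dvdn_leq_log ?cardG_gt0 // cardSg.
case/negP: nabG; apply/cyclic_abelian/Phi_quotient_cyclic.
apply: pgroup_logn1_cyclic p_pr _ _; first exact: quotient_pgroup.
have := logn_Lagrange p (Phi_sub G); rewrite -card_quotient ?gFnorm //.
card_lia.
Qed.

(** The centraliser C of Z_2(G) has index p and contains the uncovered x. If C
    were not abelian, C' would have order p and be normal, hence equal to
    Z(G); the commutators of x with C would be central, hence trivial, and
    the centre of C, containing Z_2(G) and x, would be too large. So C is an
    abelian maximal subgroup. *)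
Lemma Outc_eq1_class4 (gT : finGroupType) (p : nat) (G : {group gT}) (x : gT) :
  prime p -> p.-group G -> logn p #|G| = 5 -> #|'Z(G)| = p ->
  nil_class G = 4 -> x \in G :\: G^`(1) ->
  ~~ ('Z(G) \subset [set [~ x, g] | g in G]) -> Outc G = 1.
Proof.
move=> p_pr pG lgG oZ clG GG'x notcov.
have lgZ: logn p #|'Z(G)| = 1%N by rewrite oZ (logn_prime p p_pr) eqxx.
have nabG : ~~ abelian G by rewrite -nil_class1 clG.
have sZG' : 'Z(G) \subset G^`(1) by apply: center_sub_der1 pG nabG _; rewrite oZ.
have lgZ2 := class4_p5_logn_ucn2 p_pr pG lgG lgZ clG.
have [cx notZ2x cxZ2] := uncovered_element p_pr oZ sZG' GG'x notcov.
have /setDP[Gx _] := GG'x.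
have sZ2G := ucn_sub 2 G; have pZ2 : p.-group 'Z_2(G) := pgroupS sZ2G pG.
have cZ2 : abelian 'Z_2(G) by apply: (p2group_abelian pZ2); rewrite /= lgZ2.
have [C defC] : exists C : {group gT}, C :=: 'C_G('Z_2(G)).
  by exists 'C_G('Z_2(G))%G.
have sCG : C \subset G by rewrite defC subsetIl.
have pC := pgroupS sCG pG.
have nsCG : C <| G by rewrite defC (normalGI (ucn_norm 2 G)) ?cent_normal.
have Cx : x \in C by rewrite defC inE Gx.
have sZ2C : 'Z_2(G) \subset 'Z(C).
  rewrite subsetI {1}defC subsetI sZ2G centsC defC subsetIr.
  by rewrite (subset_trans cZ2) ?centS.
have lgC : logn p #|C| = 4.
  have : logn p #|G| <= logn p #|'C_G('Z_2(G))| + logn p #|'Z(G)|.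
    by apply: logn_cent_ucn2 => //; rewrite lgZ2 lgZ.
  rewrite -defC => leGC.
  suff: logn p #|C| < logn p #|G| by card_lia.
  apply: (properG_ltn_log pG); rewrite properEneq sCG andbT.
  apply/eqP=> eqCG; have := center_lt_ucn2 pG nabG; rewrite ltnNge.
  move: sZ2C; rewrite eqCG => sZ2Z.
  by rewrite dvdn_leq_log ?cardG_gt0 // cardSg.
have iC : #|G : C| = p by apply: index_eq_prime pG sCG _; card_lia.
apply: (Outc_abelian_index_p p_pr pG sCG _ iC); apply/idPn=> nabC.
have lgZC := logn_center_nonabelian p_pr pC nabC.
have lgZ2C : logn p #|'Z_2(G)| < logn p #|'Z(C)|.
  apply: properG_ltn_log (pgroupS (center_sub C) pC) _.
  apply/properP; split=> //; exists x => //=.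
  have leZ2 : logn p #|'Z_2(G)| <= logn p #|'Z(C)|.
    by rewrite dvdn_leq_log ?cardG_gt0 // cardSg.
  have oC' : #|C^`(1)| = p.
    by apply: card_der1_center_index_p2 p_pr pC nabC _; card_lia.
  have nsC'G : C^`(1) <| G := char_normal_trans (der_char 1 C) nsCG.
  have C'Z : C^`(1) = 'Z(G).
    have prC' : prime #|C^`(1)%G| by rewrite oC'.
    case: (prime_subgroupVti 'Z(G)%G prC') => [sC'Z | ti].
      by apply/eqP; rewrite eqEcard sC'Z oC' oZ leqnn.
    have /negP[] : C^`(1) :&: 'Z(G) != 1; last by rewrite setIC ti.
    apply: meet_center_nil (pgroup_nil pG) nsC'G _.
    by rewrite -cardG_gt1 oC' prime_gt1.
  rewrite inE Cx; apply/centP=> u Cu; apply/commgP; apply/eqP; apply: cx.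
    exact: subsetP sCG u Cu.
  by rewrite -C'Z mem_commg.
card_lia.
Qed.

(** * Order p^5 with a larger centre *)

(** In the central quotient, x generates its own centraliser modulo the
    centre. *)
Lemma cent1_quotient_center (gT : finGroupType) (p : nat) (G : {group gT}) (x g : gT) :
  prime p -> p.-group G ->
  logn p #|G / 'Z(G)| = (logn p #|'Z(G / 'Z(G))| + 2)%N ->
  x \in G -> x \notin 'Z_2(G) -> g \in G -> [~ x, g] \in 'Z(G) ->
  exists i, exists2 u, u \in 'Z_2(G) & g = x ^+ i * u.
Proof.
move=> p_pr pG lgQ Gx notZ2x Gg Zxg.
have nZ : G \subset 'N('Z(G)) := normal_norm (center_normal G).
have nZx := subsetP nZ x Gx; have nZg := subsetP nZ g Gg.
have defZQ : 'Z_2(G) / 'Z(G) = 'Z(G / 'Z(G)) by have := ucn_central 1 G; rewrite ucn1.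
have sZZ2 : 'Z(G) \subset 'Z_2(G) by rewrite -ucn1 ucn_subS.
have memZ2 u : u \in 'N('Z(G)) -> coset 'Z(G) u \in 'Z(G / 'Z(G)) -> u \in 'Z_2(G).
  move=> nZu; rewrite -defZQ -!sub1set -quotient_set1 // quotientSGK ?sub1set //.
set Q := G / 'Z(G); set X := coset 'Z(G) x.
have pQ : p.-group Q by apply: quotient_pgroup.
have QX : X \in Q :\: 'Z(Q).
  by rewrite inE mem_quotient // andbT; apply: contra notZ2x; apply: memZ2.
have /andP[ltZC ltCQ] := logn_cent1_bounds pQ QX.
have iC : #|'C_Q[X] : 'Z(Q)| = p.
  apply: index_eq_prime; first exact: pgroupS (subsetIl _ _) pQ.
    exact: proper_sub (center_proper_cent1 QX).
  rewrite /Q in lgQ ltZC ltCQ *; card_lia.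
have defC : 'Z(Q) * <[X]> = 'C_Q[X].
  apply: mul_index_p_cycle p_pr _ _ iC _; first exact: pgroupS (subsetIl _ _) pQ.
    exact: proper_sub (center_proper_cent1 QX).
  case/setDP: QX => QX nZX; apply/setDP; split=> //.
  by rewrite inE QX cent1id.
have : coset 'Z(G) g \in 'Z(Q) * <[X]>.
  rewrite defC inE mem_quotient //=; apply/cent1P.
  apply/commute_sym/commgP; rewrite -morphR //; apply/eqP.
  by rewrite /= coset_id.
case/mulsgP=> U _ ZU /cycleP[i ->] defg.
exists i, (x ^- i * g); last by rewrite mulKVg.
apply: memZ2; first by rewrite groupM ?groupV ?groupX.
rewrite morphM ?groupV ?groupX //= morphV ?groupX //= morphX //= defg -/X.
have /setIP[_ /centP cU] := ZU.
rewrite (cU (X ^+ i)) ?mulKg //.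
by rewrite groupX //; case/setDP: QX.
Qed.

(** The central quotient is extraspecial of order p ^ 3. A class-preserving
    automorphism a agrees modulo Z(G) with conjugation by some h, as can be
    arranged on two generators x and y, and it agrees exactly with it on
    Z_2(G), which is generated by Z(G) and [x, y]. For g outside Z_2(G), a
    conjugator k of g centralises g modulo Z(G) once corrected by h, so it can
    be taken to be u h with u in Z_2(G). Only the class of u modulo Z(G)
    matters: there are p conjugations to choose from, and the covering
    principle makes one choice serve all g. *)
Lemma Outc_extraspecial_central_quotient (gT : finGroupType) (p : nat) (G : {group gT}) :
  prime p -> p.-group G -> ~~ (G^`(1) \subset 'Z(G)) ->
  logn p #|G| = (logn p #|'Z(G)| + 3)%N -> Outc G = 1.
Proof.
move=> p_pr pG notG'Z lgG.
have nZ : G \subset 'N('Z(G)) := normal_norm (center_normal G).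
have pQ : p.-group (G / 'Z(G)) by apply: quotient_pgroup.
have nabQ : ~~ abelian (G / 'Z(G)).
  by apply: contra notG'Z; apply: der1_min.
have nabG : ~~ abelian G.
  by apply: contra notG'Z => /commG1P G1; rewrite derg1 G1 sub1G.
have lgQ : logn p #|G / 'Z(G)| = 3.
  have := logn_Lagrange p (center_sub G); rewrite -card_quotient //; card_lia.
have lgZQ : logn p #|'Z(G / 'Z(G))| = 1%N.
  have := logn_center_nonabelian p_pr pQ nabQ.
  have := center_lt_ucn2 pG nabG; rewrite (logn_ucn2 p G); card_lia.
have lgZ2 : logn p #|'Z_2(G)| = (logn p #|'Z(G)| + 1)%N.
  by rewrite (logn_ucn2 p G) lgZQ.
have lgQZ : logn p #|G / 'Z(G)| = (logn p #|'Z(G / 'Z(G))| + 2)%N.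
  by rewrite lgQ lgZQ.
have centQ := cent1_quotient_center p_pr pG lgQZ.
have sZ2G := ucn_sub 2 G.
have pZ2 : p.-group 'Z_2(G) := pgroupS sZ2G pG.
have sZZ2 : 'Z(G) \subset 'Z_2(G) by rewrite -ucn1 ucn_subS.
have sG'Z2 : G^`(1) \subset 'Z_2(G).
  apply: der1_min; first exact: ucn_norm.
  apply: (p2group_abelian (p := p)); first exact: quotient_pgroup.
  have := logn_Lagrange p sZ2G; rewrite -card_quotient ?ucn_norm //; card_lia.
have iZ : #|'Z_2(G) : 'Z(G)| = p by apply: index_eq_prime; rewrite ?sZZ2 //= lgZ2.
have [x Gx notZ2x] : exists2 x, x \in G & x \notin 'Z_2(G).
  apply/subsetPn; apply: contra nabQ => sGZ.
  rewrite (_ : G / 'Z(G) = 'Z(G / 'Z(G))) ?center_abelian //.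
  have Z2G : 'Z_2(G) = G by apply/eqP; rewrite eqEsubset sGZ ucn_sub.
  by have := ucn_central 1 G; rewrite Z2G ucn1.
have [y Gy notZxy] : exists2 y, y \in G & [~ x, y] \notin 'Z(G).
  apply/exists_inP; apply: contraR notZ2x; rewrite negb_exists_in.
  move/forall_inP=> xG; apply/ucn2P; split=> // g Gg.
  by have := xG g Gg; rewrite negbK.
have notZ2y : y \notin 'Z_2(G).
  apply: contra notZxy => /ucn2P[_ yG]; rewrite -invg_comm groupV; exact: yG.
have Z2b : [~ x, y] \in 'Z_2(G) by rewrite (subsetP sG'Z2) // mem_commg.
have defZ2 : 'Z(G) * <[ [~ x, y] ]> = 'Z_2(G).
  by apply: (mul_index_p_cycle p_pr pZ2 sZZ2 iZ); rewrite inE notZxy.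
(* Modulo Z(G), the centraliser of y has index p and omits x. *)
have decomp k : k \in G ->
    exists i, exists l, [/\ l \in G, [~ y, l] \in 'Z(G) & k = l * x ^+ i].
  move=> Gk; set Q := G / 'Z(G); set Y := coset 'Z(G) y; set X := coset 'Z(G) x.
  have nZx := subsetP nZ x Gx; have nZy := subsetP nZ y Gy.
  have nZk := subsetP nZ k Gk.
  have QY : Y \in Q :\: 'Z(Q).
    rewrite inE mem_quotient // andbT; apply: contra notZxy => /setIP[_ /centP cY].
    rewrite coset_idr ?groupR //= morphR //=; apply/eqP/commgP/commute_sym/cY.
    exact: mem_quotient.
  have /andP[ltZC ltCQ] := logn_cent1_bounds pQ QY.
  have iC : #|Q : 'C_Q[Y]| = p.
    apply: (index_eq_prime pQ (subsetIl _ _)).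
    rewrite /Q in lgQ ltZC ltCQ *; card_lia.
  have defQ : 'C_Q[Y] * <[X]> = Q.
    apply: mul_index_p_cycle p_pr pQ (subsetIl _ _) iC _.
    rewrite inE [X \in Q]mem_quotient // andbT inE mem_quotient //=.
    apply: contra notZxy => /cent1P cYX.
    rewrite coset_idr ?groupR //= morphR //=; apply/eqP/commgP.
    exact: commute_sym.
  have : coset 'Z(G) k \in 'C_Q[Y] * <[X]> by rewrite defQ mem_quotient.
  case/mulsgP=> U _ /setIP[_ /cent1P cYU] /cycleP[i ->] defk.
  exists i, (k * x ^- i); rewrite mulgKV groupM ?groupV ?groupX //; split=> //.
  have nZl : k * x ^- i \in 'N('Z(G)) by rewrite groupM ?groupV ?groupX.
  rewrite coset_idr ?groupR //= morphR //= morphM ?groupV ?groupX //=.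
  rewrite morphV ?groupX //= morphX //= defk mulgK.
  exact/eqP/commgP.
(* x and y generate G modulo its centre. *)
have genG (K : {group gT}) : 'Z(G) \subset K -> x \in K -> y \in K -> G \subset K.
  move=> sZK Kx Ky.
  have sZ2K : 'Z_2(G) \subset K.
    by rewrite -defZ2 mul_subG // cycle_subG groupR.
  apply/subsetP=> g /decomp[i [l [Gl Zyl ->]]].
  have [j [u Z2u ->]] := centQ y l Gy notZ2y Gl Zyl.
  by rewrite !groupM ?groupX // (subsetP sZ2K).
apply/Outc_eq1P=> a Aca; have [Aa ca] := AutcP Aca.
have [h0 Gh0 axh0] := ca x Gx; have [k Gk ayk] := ca y Gy.
have [|i [l [Gl Zyl kE]]] := decomp (k * h0^-1); first by rewrite groupM ?groupV.
(* Multiplying h0 by a power of x leaves the image of x alone, and the power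
   is chosen to correct the image of y modulo Z(G). *)
pose h := x ^+ i * h0; have Gh : h \in G by rewrite groupM ?groupX.
have axh : a x = x ^ h 
  by rewrite axh0 /h conjgM [x ^ _ ^+ i]conjgE (commuteX i (commute_refl x)) mulKg.
have ayh : a y = y ^ h * [~ y, l].
  have -> : a y = (y * [~ y, l]) ^ h.
    by rewrite -conjg_mulR -conjgM ayk /h mulgA -kE mulgKV.
  rewrite conjMg; congr (_ * _); have /setIP[_ /centP cyl] := Zyl.
  by rewrite /conjg (cyl h Gh) mulKg.
have aZ z : z \in 'Z(G) -> a z = z ^ h.
  case/setIP=> Gz /centP cz; have [g Gg ->] := ca z Gz.
  by rewrite /conjg !cz // !mulKg.
have [K defK] := conj_agreement h Aa.
have sZ2K : 'Z_2(G) \subset K.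
  rewrite -defZ2 mul_subG //.
    by apply/subsetP=> z Zz; rewrite defK aZ // eqxx (subsetP (center_sub G)).
  rewrite cycle_subG defK groupR //= -(autmE Aa) morphR //= !autmE axh ayh.
  have /setIP[_ /centP cyl] := Zyl.
  rewrite conjRg; apply/eqP.
  have cyl' v : v \in G -> v ^ [~ y, l] = v.
    by move=> Gv; rewrite /conjg -(cyl v Gv) mulKg.
  rewrite commgMJ cyl' ?groupR ?groupJ //.
  rewrite [X in X * _ = _](_ : _ = 1) ?mul1g //.
  by apply/eqP/commgP/commute_sym/cyl; rewrite groupJ.
have aQ : {in G, forall g, (g ^ h)^-1 * a g \in 'Z(G)}.
  pose L := [set g in G | (g ^ h)^-1 * a g \in 'Z(G)].
  have memL g : (g \in L) = (g \in G) && ((g ^ h)^-1 * a g \in 'Z(G)) by rewrite in_set.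
  have gL : group_set L.
    apply/group_setP; split=> [|u v].
      by rewrite memL group1 -(autmE Aa) morph1 conj1g invg1 mul1g group1.
    rewrite !memL => /andP[Gu Zu] /andP[Gv Zv]; rewrite groupM //=.
    rewrite -(autmE Aa) morphM //= !autmE conjMg invMg.
    have /setIP[_ /centP cu] := Zu.
    have -> : (v ^ h)^-1 * (u ^ h)^-1 * (a u * a v)
                = (u ^ h)^-1 * a u * ((v ^ h)^-1 * a v).
      rewrite -[X in X = _]mulgA [X in _ * X = _]mulgA mulgA.
      by rewrite -(cu (v ^ h)^-1) ?groupV ?groupJ // -!mulgA.
    exact: groupM.
  suff sGL : G \subset Group gL.
    by move=> g /(subsetP sGL); rewrite [_ \in _]memL => /andP[].
  apply: genG.
  - apply/subsetP=> z Zz; rewrite [_ \in _]memL aZ // mulVg group1 andbT.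
    exact: subsetP (center_sub G) z Zz.
  - by rewrite [_ \in _]memL Gx axh mulVg group1.
  by rewrite [_ \in _]memL Gy ayh mulKg.
pose B := [set repr C * h | C in rcosets 'Z(G) 'Z_2(G)].
have leBp : #|B| <= p by apply: leq_trans (leq_imset_card _ _) _; rewrite -iZ.
have reprZ u : exists2 z, z \in 'Z(G) & repr ('Z(G) :* u) = z * u.
  by have /rcosetP[z Zz ->] := mem_repr_rcoset [group of 'Z(G)] u; exists z.
have conjZ g z : g \in G -> z \in 'Z(G) -> g ^ z = g.
  by move=> Gg /setIP[_ /centP cz]; rewrite /conjg -(cz g Gg) mulKg.
have covG : {in G, forall g, exists2 b, b \in B & a g = g ^ b}.
  move=> g Gg; have [Z2g | notZ2g] := boolP (g \in 'Z_2(G)).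
    exists (repr ('Z(G) :* 1) * h).
      apply/imsetP; exists ('Z(G) :* 1) => //; apply/rcosetsP.
      by exists 1; rewrite ?group1.
    have [z Zz ->] := reprZ 1; rewrite mulg1 conjgM (conjZ g z) //.
    by have := subsetP sZ2K g Z2g; rewrite defK => /andP[_ /eqP].
  have [k' Gk' agk] := ca g Gg.
  have Gkh : k' * h^-1 \in G by rewrite groupM ?groupV.
  have Zg : [~ g, k' * h^-1] \in 'Z(G).
    have := aQ g Gg; rewrite agk -(memJ_norm _ (subsetP nZ h^-1 (groupVr Gh))).
    by rewrite conjMg conjVg -!conjgM mulgV conjg1.
  have [j [u Z2u kE']] := centQ g (k' * h^-1) Gg notZ2g Gkh Zg.
  exists (repr ('Z(G) :* u) * h).
    apply/imsetP; exists ('Z(G) :* u) => //; apply/rcosetsP.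
    by exists u.
  have [z Zz ->] := reprZ u; rewrite agk -(mulgKV h k') kE' !conjgM (conjZ g z) //.
  by rewrite [g ^ _ ^+ j]conjgE (commuteX j (commute_refl g)) mulKg.
have [b Bb ab] := uniform_conjugator p_pr pG (subxx G) Aa leBp covG.
exists b => //; have [C /rcosetsP[u Z2u ->] ->] := imsetP Bb.
have [z Zz ->] := reprZ u.
have Gz := subsetP (center_sub G) z Zz; have Gu := subsetP sZ2G u Z2u.
exact: groupM (groupM Gz Gu) Gh.
Qed.

(** A centraliser of index p of a non-central element is abelian, because the
    centre is large. If there is none, the centre has order p ^ 2; then, for N
    of order p in Z(G), an element central modulo N has at most p conjugates
    and so lies in Z(G). Thus G / N has order p ^ 4 and centre of order p, so
    its class is not 2, and G' is not central. *)
Lemma Outc_large_center (gT : finGroupType) (p : nat) (G : {group gT}) :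
  prime p -> p.-group G -> logn p #|G| = 5 -> ~~ abelian G ->
  1 < logn p #|'Z(G)| -> Outc G = 1.
Proof.
move=> p_pr pG lgG nabG lgZ; have lgZ3 := logn_center_nonabelian p_pr pG nabG.
have [/exists_inP[x GZx lgC] | ] :=
    boolP [exists x in G :\: 'Z(G), 3 < logn p #|'C_G[x]|].
  have /andP[_ ltCG] := logn_cent1_bounds pG GZx.
  have iC : #|G : 'C_G[x]| = p.
    by apply: (index_eq_prime pG (subsetIl _ _)); card_lia.
  apply: (Outc_abelian_index_p p_pr pG (subsetIl _ _) _ iC).
  by apply: (cent1_abelian p_pr pG GZx); card_lia.
rewrite negb_exists_in => /forall_inP smallC.
have {}smallC x : x \in G :\: 'Z(G) -> logn p #|'C_G[x]| <= 3.
  by move/smallC; rewrite -leqNgt.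
have lgZ2 : logn p #|'Z(G)| = 2.
  have [x GZx] := nonabelian_noncentral nabG.
  have /andP[ltZC _] := logn_cent1_bounds pG GZx.
  have := smallC x GZx; card_lia.
apply: (Outc_extraspecial_central_quotient p_pr pG); last by rewrite lgG lgZ2.
have p_dv_Z : p %| #|'Z(G)|.
  by move: lgZ2; rewrite lognE; case: and3P => // -[].
have [z Zz oz] := Cauchy p_pr p_dv_Z.
have sNZ : <[z]> \subset 'Z(G) by rewrite cycle_subG.
have sNG := subset_trans sNZ (center_sub G).
have nsNG : <[z]> <| G := sub_center_normal sNZ.
have nNG := normal_norm nsNG.
have pQ : p.-group (G / <[z]>) by apply: quotient_pgroup.
have lgN : logn p #|<[z]>| = 1%N by rewrite -orderE oz (logn_prime p p_pr) eqxx.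
have lgQ : logn p #|G / <[z]>| = 4.
  have := logn_Lagrange p sNG; rewrite -card_quotient //; card_lia.
have lgZN : logn p #|'Z(G) / <[z]>| = 1%N.
  have := logn_Lagrange p sNZ; rewrite -card_quotient; first card_lia.
  exact: subset_trans (center_sub G) nNG.
have sZQ : 'Z(G / <[z]>) \subset 'Z(G) / <[z]>.
  apply/subsetP=> X /setIP[/morphimP[x nNx Gx ->] /centP cX].
  apply: mem_quotient; apply/idPn=> notZx.
  have GZx : x \in G :\: 'Z(G) by rewrite inE notZx.
  have xGN : {in G, forall g, [~ x, g] \in <[z]>}.
    move=> g Gg; have nNg := subsetP nNG g Gg.
    rewrite coset_idr ?groupR //= morphR //=; apply/eqP/commgP/cX.
    exact: mem_quotient.
  have := logn_cent1 p_pr pG (pgroupS sNG pG) xGN.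
  have := smallC x GZx; card_lia.
apply/negP=> sG'Z.
have : 1 < logn p #|'Z(G / <[z]>)|.
  apply: logn_center_class2_p4 p_pr pQ lgQ _.
  rewrite -quotient_der //; apply: subset_trans (quotientS _ sG'Z) _.
  by apply: subset_trans (morphim_center _ _) _ => //.
have := dvdn_leq_log p (cardG_gt0 _) (cardSg sZQ).
card_lia.
Qed.

(** * The characterisation *)

Lemma logn_center_gt0 (gT : finGroupType) (p : nat) (G : {group gT}) :
  p.-group G -> 0 < logn p #|G| -> 0 < logn p #|'Z(G)|.
Proof.
move=> pG lgG; have pZ : p.-group 'Z(G) := pgroupS (center_sub G) pG.
rewrite lt0n; apply/negP=> /eqP lgZ.
have Z1 : 'Z(G) = 1 by apply: card1_trivg; rewrite (card_pgroup pZ) lgZ.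
by rewrite (trivg_center_pgroup pG Z1) cards1 logn1 in lgG.
Qed.

Theorem theorem2p3 (gT : finGroupType) (G : {group gT}) (p : nat) :
  prime p -> #|G| = (p ^ 5)%N -> ~~ abelian G ->
  Outc G <> 1 <->
  [/\ #|'Z(G)| = p,
      'Z(G) \proper G^`(1)
    & (nil_class G = 3 /\ 'm(G) = 3)
      \/ (nil_class G = 4 /\
          forall x, x \in G :\: G^`(1) ->
            'Z(G) \subset [set [~ x, g] | g in G])].
Proof.
move=> p_pr oG nabG.
have lgG : logn p #|G| = 5 by rewrite oG pfactorK.
have pG : p.-group G by rewrite /pgroup oG pnatX pnat_id.
split; last first.
  case=> oZ _ [[clG mG] | [clG covZ]]; first exact: Outc_neq1_class3 lgG oZ clG mG.
  exact: Outc_neq1_class4 lgG oZ clG covZ.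
move=> ntOut.
have lgZ1 : logn p #|'Z(G)| = 1%N.
  apply/eqP; rewrite eqn_leq logn_center_gt0 ?lgG // andbT leqNgt.
  by apply/negP=> /(Outc_large_center p_pr pG lgG nabG).
have pZ : p.-group 'Z(G) := pgroupS (center_sub G) pG.
have oZ : #|'Z(G)| = p by rewrite (card_pgroup pZ) lgZ1 expn1.
have sZG' : 'Z(G) \subset G^`(1) by apply: center_sub_der1 pG nabG _; rewrite oZ.
have iZ : #|G : 'Z(G)| = (p ^ 4)%N.
  by rewrite -divgS ?center_sub // oG oZ expnS mulKn ?prime_gt0.
have lgPhi : logn p #|G| = (logn p #|'Phi(G)| + logn p #|G / 'Phi(G)|)%N.
  by rewrite card_quotient ?gFnorm // -logn_Lagrange ?Phi_sub.
have mG := grank_leq_Phi pG.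
have sG'Phi : G^`(1) \subset 'Phi(G) by rewrite (Phi_joing pG) joing_subl.
have leG'Phi : logn p #|G^`(1)| <= logn p #|'Phi(G)|.
  by rewrite dvdn_leq_log ?cardG_gt0 // cardSg.
have notG'Z : ~~ (G^`(1) \subset 'Z(G)).
  apply/negP=> sG'Z; apply: ntOut; apply: Outc_eq1_card; rewrite iZ.
  have G'Z : G^`(1) = 'Z(G) by apply/eqP; rewrite eqEsubset sG'Z.
  rewrite G'Z oZ leq_exp2l ?prime_gt1 //.
  by rewrite G'Z in leG'Phi; card_lia.
have clG : nil_class G \in [:: 3; 4].
  have := nil_class_pgroup pG; rewrite lgG /=.
  have : 2 < nil_class G by rewrite ltnNge nil_class2.
  by case: (nil_class G) => [|[|[|[|[|n]]]]].
split=> //; first by rewrite properE sZG'.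
move: clG; rewrite !inE => /orP[/eqP clG | /eqP clG]; [left | right]; split=> //.
  have [_ lgG'] := class3_p5_logn p_pr pG lgG lgZ1 sZG' clG.
  have m2 : 2 < 'm(G).
    rewrite ltnNge; apply/negP=> m2; apply: ntOut; apply: Outc_eq1_card.
    rewrite iZ (card_pgroup (pgroupS (der_sub 1 G) pG)) lgG' -expnM.
    by rewrite leq_exp2l ?prime_gt1 // (leq_mul2l 2 _ 2).
  apply/eqP; rewrite eqn_leq m2 andbT; move: mG lgPhi leG'Phi; card_lia.
move=> x GG'x; apply/idPn=> notcov; apply: ntOut.
exact: Outc_eq1_class4 lgG oZ clG GG'x notcov.
Qed.
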